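(* The maximum order $n$ of an Abelian group $\Gamma$ having a covering difference set $S$ of cardinality $s=7$ is $n=39$. The set $S=\{0,1,2,4,13,18,33\}$ in $\mathbb{Z}_{39}$ provides a $(39,7,1,34)$ almost difference set (in particular it is a covering difference set of $\mathbb{Z}_{39}$).
   Context: Let $\Gamma$ be a finite Abelian group (written additively) and $S\subseteq\Gamma$. $S$ is a covering difference set (covering set) of $\Gamma$ if every element of $\Gamma$ is of the form $t-t'$ for some $t,t'\in S$. An $(n,s,\lambda,t)$-almost difference set (ADS) is a subset $S$ of size $s$ of a group of order $n$ such that the multiset of differences of elements of $S$ contains exactly $t$ of the non-identity group elements exactly $\lambda$ times each, and all other non-identity group elements exactly $\lambda+1$ times each. *)

(* Defs.v *)
From mathcomp Require Import all_boot all_order all_fingroup all_algebra.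

Set Implicit Arguments.
Unset Strict Implicit.
Unset Printing Implicit Defensive.

Import GRing.Theory.
Local Open Scope ring_scope.

Definition covering_difference_set (G : finZmodType) (S : {set G}) : Prop :=
  forall g : G, exists t t' : G, [/\ t \in S, t' \in S & g = t - t'].

(* Differences are taken over ordered pairs. *)
Definition diff_mult (G : finZmodType) (S : {set G}) (g : G) : nat :=
  #|[set p in setX S S | p.1 - p.2 == g]|.

Definition almost_difference_set (G : finZmodType) (n s lambda t : nat)
    (S : {set G}) : Prop :=
  [/\ #|G| = n,
      #|S| = s,
      #|[set g : G | (g != 0) && (diff_mult S g == lambda)]| = t
    & forall g : G, g != 0 -> diff_mult S g <> lambda ->
        diff_mult S g = lambda.+1].

Definition has_covering_order (s n : nat) : Prop :=
  exists (G : finZmodType) (S : {set G}),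
    [/\ #|G| = n, #|S| = s & covering_difference_set S].

Definition is_maximum (P : nat -> Prop) (n : nat) : Prop :=
  P n /\ forall m : nat, P m -> (m <= n)%N.

Definition S39 : {set 'Z_39} := [set 0; 1; 2; 4; 13; 18; 33].

(* Main.v *)
(* A set of size 7 has 42 differences of distinct elements, so a group that it
   covers has order at most 43. Abelian groups of order 41, 42 or 43 are cyclic.
   A non-cyclic one of order 40 has a subgroup H of index 2 and an involution
   outside H; an involution is a difference in an even number of ways, so with
   a = |S :&: H| and b = |S :\: H| we have 2ab >= 21 and a^2 + b^2 >= 7 + 19,
   against a + b = 7. In a cyclic group of order 40 to 43, the
   difference 1 occurs, so some translate of S contains 0 and 1, and a pruned
   exhaustive search finds no such covering set. *)
Require Import Defs.
From mathcomp Require Import all_boot all_order all_fingroup all_algebra.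
From mathcomp Require Import all_solvable zify.

Set Implicit Arguments.
Unset Strict Implicit.
Unset Printing Implicit Defensive.

Import GRing.Theory.

(** * Pruned search over the residues modulo n *)

(* Differences modulo [n] are considered up to sign, and represented in [0, n/2]. *)
Definition fold_diff (n d : nat) : nat := minn d (n - d).

Fixpoint fold_diffs (n : nat) (acc s : seq nat) : seq nat :=
  if s is a :: s' then
    [seq fold_diff n (a - b) | b <- acc] ++ fold_diffs n (a :: acc) s'
  else [::].

Fixpoint pairs_left (m k : nat) : nat :=
  if k is k'.+1 then m + pairs_left m.+1 k' else 0.

(* Can [k] elements of [n - f, n) be added to [acc] so that the new folded
   differences include all of [D]? A branch is cut when [D] has more elements
   than there are pairs still to be formed. The test is written with [if] so
   that call-by-value evaluation does not explore the cut branches. *)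
Fixpoint search (n f k : nat) (acc D : seq nat) : bool :=
  match k, f with
  | 0, _ => nilp D
  | _, 0 => false
  | k'.+1, f'.+1 =>
    let a := n - f in
    let ds := [seq fold_diff n (a - b) | b <- acc] in
    let D' := [seq d <- D | d \notin ds] in
    if (if size D' <= pairs_left (size acc).+1 k'
        then search n f' k' (a :: acc) D' else false)
    then true else search n f' k acc D
  end.

Lemma size_fold_diffs n acc s :
  size (fold_diffs n acc s) = pairs_left (size acc) (size s).
Proof.
by elim: s acc => [|a s IHs] acc //=; rewrite size_cat size_map IHs.
Qed.

(** When the scan reaches [j], every smaller element of [s] has already moved into [acc], so the
    pair is formed at that moment. *)
Lemma mem_fold_diffs n acc s i j :
    sorted ltn s -> j \in s -> (i \in acc) || (i \in s) && (i < j) ->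
  fold_diff n (j - i) \in fold_diffs n acc s.
Proof.
elim: s acc => // a s IHs acc /= a_s; rewrite mem_cat inE.
have s_sorted := path_sorted a_s.
have /allP a_min := order_path_min ltn_trans a_s.
case/predU1P=> [-> | js] i_in; last first.
  apply/orP; right; apply: IHs => //; move: i_in; rewrite !inE.
  by case: (i \in acc); case: (i == a) => //=; rewrite ?orbT.
apply/orP; left; apply: map_f; case/orP: i_in => // /andP[].
by rewrite inE => /predU1P[-> | /a_min /=]; lia.
Qed.

(** Pruning is sound because the duplicate-free [D'] lies in the differences still to come, a list
    whose length is given by [pairs_left]; this is why [uniq D] is carried along the induction. *)
Lemma search_complete n f k acc D s :
    f <= n -> subseq s (iota (n - f) f) -> size s = k -> uniq D ->
  {subset D <= fold_diffs n acc s} -> search n f k acc D.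
Proof.
elim: f k acc D s => [|f IHf] k acc D s le_fn /=.
  by move=> /eqP-> <- _; case: D => // d D /(_ d); rewrite mem_head => /(_ isT).
case: s => [_ <- _ | a s].
  by case: D => // d D /(_ d); rewrite mem_head => /(_ isT).
have nf : (n - f.+1).+1 = n - f by lia.
case: k => // k sub_s [size_s] uniqD subD; rewrite /= in sub_s *.
move: sub_s; rewrite nf; case: eqP => [def_a | _] sub_s; last first.
  case: ifP => // _; apply: IHf sub_s _ uniqD subD => //=; [lia | by rewrite size_s].
set D' := filter _ _.
have subD' : {subset D' <= fold_diffs n (a :: acc) s}.
  move=> d; rewrite mem_filter => /andP[d_new /subD] /=.
  by rewrite mem_cat def_a (negPf d_new).
have uniqD' : uniq D' by apply: filter_uniq.
have := uniq_leq_size uniqD' subD'.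
rewrite size_fold_diffs size_s /= => ->; rewrite -def_a.
by rewrite (IHf _ _ _ s) //; lia.
Qed.

Local Open Scope ring_scope.

(** * From covering sets of cyclic groups to the search *)

Lemma cyclic_zmod_generator (G : finZmodType) :
  cyclic [set: G] -> exists x : G, forall g : G, exists2 k, (k < #|G|)%N & g = x *+ k.
Proof.
case/cyclicP=> x def_G; exists x => g.
have : g \in <[x]>%g by rewrite -def_G inE.
case/cyclePmin=> k lt_k ->; exists k; last by rewrite FinRing.zmodXgE.
by rewrite -cardsT def_G.
Qed.

Lemma mulrn_inj_of_surj (G : finZmodType) (x : G) :
    (forall g : G, exists2 k, (k < #|G|)%N & g = x *+ k) ->
  {in gtn #|G| &, injective (fun k => x *+ k)}.
Proof.
move=> x_gen.
have surj : codom (fun k : 'I_#|G| => x *+ k) =i G.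
  move=> g; rewrite !inE; have [k lt_k ->] := x_gen g.
  exact: (codom_f (fun k : 'I_#|G| => x *+ k) (Ordinal lt_k)).
have /image_injP inj : #|image (fun k : 'I_#|G| => x *+ k) 'I_(#|G|)| == #|'I_(#|G|)|.
  by rewrite (eq_card surj) card_ord.
move=> i j lt_i lt_j eq_ij.
by have := inj (Ordinal lt_i) (Ordinal lt_j) isT isT eq_ij => /(congr1 val).
Qed.

(** If the generator is [t1 - t0] with both in [S], translating by [- t0] puts 0 and 1 among the
    exponents. They form the initial accumulator and realise the folded difference 1, so only 2 up
    to half the order remain to be found. *)
Lemma cyclic_search (G : finZmodType) (S : {set G}) :
    (2 < #|G|)%N -> cyclic [set: G] -> covering_difference_set S ->
  search #|G| (#|G| - 2) (#|S| - 2) [:: 1%N; 0%N] (iota 2 (#|G|./2.-1)).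
Proof.
have [m cardG] : {m | #|G| - 2 = m}%N by exists (#|G| - 2)%N.
move=> G_gt2; have {}cardG : #|G| = m.+2 by lia.
move=> /cyclic_zmod_generator[x x_gen] covS.
have x_inj := mulrn_inj_of_surj x_gen; rewrite cardG in x_gen x_inj.
have [t1 [t0 [St1 St0 def_x]]] := covS x.
pose A := [seq k <- iota 0 m.+2 | t0 + x *+ k \in S].
have A_lt k : k \in A -> (k < m.+2)%N.
  by rewrite mem_filter mem_iota => /andP[].
have memA g : g \in S -> exists2 k, k \in A & g = t0 + x *+ k.
  have [k lt_k def_k] := x_gen (g - t0).
  have def_g : g = t0 + x *+ k by rewrite -def_k addrC subrK.
  by move=> Sg; exists k; rewrite ?mem_filter ?mem_iota -?def_g ?Sg.
have cardS : #|S| = size A.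
  rewrite -(size_map (fun k => t0 + x *+ k)) -(card_uniqP _); last first.
    rewrite map_inj_in_uniq ?filter_uniq ?iota_uniq // => i j /A_lt iA /A_lt jA.
    by move/addrI; apply: x_inj.
  apply: eq_card => g; apply/idP/mapP=> [/memA // | [k]].
  by rewrite mem_filter => /andP[Sk _] ->.
pose s := [seq k <- iota 2 m | t0 + x *+ k \in S].
have defA : A = [:: 0, 1 & s]%N.
  by rewrite /A /= mulr0n addr0 St0 mulr1n {1}def_x addrC subrK St1.
have A_sorted : sorted ltn A by apply: sorted_filter (iota_ltn_sorted _ _); exact: ltn_trans.
rewrite cardG (_ : #|S| - 2 = size s)%N; last by rewrite cardS defA /= subn2.
rewrite (_ : m.+2 - 2 = m)%N; last by rewrite subn2.
apply: (search_complete (s := s)); rewrite ?iota_uniq //.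
- by rewrite -addn2 leq_addr.
- by rewrite (_ : m.+2 - m = 2)%N ?filter_subseq //; lia.
move=> d; rewrite mem_iota => d_range.
have [t [t' [/memA[i Ai ->] /memA[j Aj ->]]]] := covS (x *+ d).
have [lt_i lt_j] := (A_lt i Ai, A_lt j Aj).
rewrite opprD addrACA subrr add0r => /eqP; rewrite eq_sym subr_eq -mulrnDr => /eqP eq_i.
(* Were this multiple equal to [x *+ k.+1], cancelling one [x] would equate the multiples [m.+1] and
   [k], although [k < m.+1]. *)
have x_order : x *+ m.+2 = 0.
  have [k lt_k def_k] := x_gen (x *+ m.+2).
  case: k lt_k def_k => [|k] lt_k; first by rewrite mulr0n.
  rewrite !mulrS => /addrI eq_k; have := @x_inj m.+1 k.
  rewrite mulrS !inE => /(_ _ _ eq_k) => E.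
  by have := E (ltnSn _) (ltnW lt_k); lia.
have fold_mem a b : a \in A -> b \in A -> (a < b)%N ->
    fold_diff m.+2 (b - a) != 1%N ->
    fold_diff m.+2 (b - a) \in fold_diffs m.+2 [:: 1; 0]%N s.
  move=> Aa Ab lt_ab; have := @mem_fold_diffs m.+2 [::] A a b A_sorted Ab.
  rewrite Aa lt_ab defA => /(_ isT) /=.
  rewrite inE => /predU1P[-> | //]; rewrite /fold_diff; lia.
(* [i] is [d + j] reduced modulo [m.+2]. Without wrap-around [i - j] is [d]; with it [j - i] is
   [m.+2 - d], which folds back to [d] since [d] is at most half the order. *)
have [lt_dj | le_dj] := ltnP (d + j) m.+2.
  have {}eq_i : i = (d + j)%N by apply: x_inj.
  have -> : d = fold_diff m.+2 (i - j) by rewrite /fold_diff; lia.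
  by apply: fold_mem => //; rewrite /fold_diff; lia.
have {}eq_i : i = (d + j - m.+2)%N.
  apply: x_inj; rewrite ?inE //; first by lia.
  by rewrite eq_i -{1}(subnK le_dj) mulrnDr x_order addr0.
have -> : d = fold_diff m.+2 (j - i) by rewrite /fold_diff; lia.
by apply: fold_mem => //; rewrite /fold_diff; lia.
Qed.

Local Close Scope ring_scope.
Local Open Scope group_scope.

(** * Involutions in non-cyclic Abelian groups of order 40 *)

(* If G has exponent 10, any g outside any H of index 2 yields the involution g^5.
   Otherwise G has an element of order 20, which generates H; then (g^5)^2 is the
   square of some y in H, and g^5 y^-1 is the involution. *)
Lemma abelian_index2_involution (gT : finGroupType) (G : {group gT}) :
    abelian G -> #|G| = 40 -> ~~ cyclic G ->
  exists (H : {group gT}) (t : gT),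
    [/\ H \subset G, #|H| = 20, t \in G, t \notin H & t ^+ 2 = 1].
Proof.
move=> cGG oG ncG.
have sqH (H : {group gT}) (g : gT) :
    H \subset G -> #|H| = 20 -> g \in G -> g ^+ 2 \in H.
  move=> sHG oH Gg.
  have nHG : H <| G by rewrite -sub_abelian_normal.
  have Ng := subsetP (normal_norm nHG) _ Gg.
  rewrite coset_idr ?groupX // morphX //.
  have <- : #|G / H| = 2 by rewrite card_quotient ?normal_norm // -divgS // oG oH.
  by rewrite expg_cardG // mem_quotient.
have outsideH (H : {group gT}) : H \subset G -> #|H| = 20 ->
    exists2 g, g \in G & g \notin H.
  move=> sHG oH; apply/subsetPn; apply: contraL isT => /subset_leq_card.
  by rewrite oG oH.
have odd_powH (H : {group gT}) (g : gT) : H \subset G -> #|H| = 20 ->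
    g \in G -> g \notin H -> g ^+ 5 \notin H.
  move=> sHG oH Gg; apply: contra.
  by rewrite (expgD g 1 4) (expgM g 2 2) groupMr // groupX // sqH.
have [x Gx exG] := exponent_witness (abelian_nil cGG).
have : exponent G %| 40 by rewrite -oG exponent_dvdn.
have prime_dvd_exp p : prime p -> p %| 40 -> p %| exponent G.
  move=> p_pr; rewrite -oG => /(Cauchy p_pr)[y Gy <-].
  exact: dvdn_exponent.
have exp_neq : exponent G != 40.
  apply: contra ncG; rewrite exG => /eqP ox.
  by apply/cyclicP; exists x; apply/esym/eqP; rewrite eqEcard cycle_subG Gx oG -ox leqnn.
have exp_10_or_20 : exponent G %| 40 -> exponent G = 10 \/ exponent G = 20.
  move=> e40; have e2 := prime_dvd_exp 2 isT isT; have e5 := prime_dvd_exp 5 isT isT.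
  have /allP : all (fun e => [&& 2 %| e, 5 %| e & e != 40] ==> (e \in [:: 10; 20]))
    (divisors 40) by [].
  move/(_ (exponent G)); rewrite -dvdn_divisors // e40 e2 e5 exp_neq => /(_ isT).
  by rewrite !inE => /orP[] /eqP; auto.
case/exp_10_or_20=> oe.
  have [P sylP] := Sylow_exists 2 G; have [sPG pP _] := and3P sylP.
  have oP : #|P| = 8 by rewrite (card_Hall sylP) oG p_part.
  have [R sylR] := Sylow_exists 5 G; have [sRG pR _] := and3P sylR.
  have oR : #|R| = 5 by rewrite (card_Hall sylR) oG p_part.
  (* The index 2 subgroup is the product of a subgroup of order 4 of the Sylow 2-subgroup and the
     Sylow 5-subgroup. *)
  have [|Q [sQP _ oQ]] := @normal_pgroup 2 gT 2 P P pP (normal_refl P).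
    by rewrite oP.
  have sQG := subset_trans sQP sPG.
  pose H := (Q <*> R)%G.
  have sHG : H \subset G by rewrite join_subG sQG.
  have oH : #|H| = 20.
    rewrite /= cent_joinEl; last exact: subset_trans sQG (subset_trans cGG (centS sRG)).
    by rewrite coprime_cardMg oQ oR.
  have [g Gg nHg] := outsideH H sHG oH; exists H, (g ^+ 5); split=> //.
  - by rewrite groupX.
  - exact: odd_powH.
  by rewrite -expgM -[(5 * 2)%N]oe expg_exponent.
pose H := <[x]>%G.
have sHG : H \subset G by rewrite cycle_subG.
have oH : #|H| = 20 by rewrite -oe exG.
have [g Gg nHg] := outsideH H sHG oH.
have g10 : (g ^+ 5) ^+ 2 \in H by apply: sqH; rewrite ?groupX.
(* The square of [g ^+ 5] is some [x ^+ k]; as [g ^+ 20] is trivial, 20 divides [k * 2], so [k] is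
   even and [x ^+ (k %/ 2)] serves as [y]. *)
have [y Hy g_y] : exists2 y, y \in H & (g ^+ 5) ^+ 2 = y ^+ 2.
  have /cycleP[k def_k] := g10; have xk : x ^+ (k * 2) = 1.
    by rewrite expgM -def_k -!expgM -[(5 * _)%N]oe expg_exponent.
  have : 20 %| k * 2 by rewrite -oe exG order_dvdn xk.
  move=> dvd_k; exists (x ^+ (k %/ 2)); first exact: mem_cycle.
  by rewrite def_k -expgM; congr (x ^+ _); lia.
have Gy := subsetP sHG y Hy.
exists H, (g ^+ 5 * y^-1); split=> //.
- by rewrite groupM ?groupV ?groupX.
- by rewrite groupMr ?groupV //; apply: odd_powH.
have cgy : commute (g ^+ 5) y^-1.
  by apply: (centsP cGG); rewrite ?groupV ?groupX.
by rewrite expgMn // g_y expgVn mulgV.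
Qed.

Local Close Scope group_scope.
Local Open Scope ring_scope.

(** * Counting differences with multiplicity *)

Lemma sum_diff_mult (G : finZmodType) (S : {set G}) (P : pred G) :
  (\sum_(g | P g) diff_mult S g = #|[set p in setX S S | P (p.1 - p.2)%R]|)%N.
Proof.
rewrite -sum1_card (partition_big (fun p : G * G => p.1 - p.2) P) /=; last first.
  by move=> p; rewrite inE => /andP[].
apply: eq_bigr => g Pg; rewrite /diff_mult -sum1_card; apply: eq_bigl => p.
by rewrite !inE -!andbA; case: eqP => [->|]; rewrite ?Pg // !andbF.
Qed.

Lemma diff_mult0 (G : finZmodType) (S : {set G}) : diff_mult S 0 = #|S|.
Proof.
have inj_diag : injective (fun t : G => (t, t)) by move=> t u [].
rewrite -(card_imset S inj_diag); apply: eq_card => -[t u].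
rewrite !inE /= subr_eq0; apply/andP/imsetP => [[/andP[St _] /eqP <-] | [v Sv [-> ->]]].
  by exists t.
by rewrite Sv.
Qed.

Lemma diff_mult_gt0 (G : finZmodType) (S : {set G}) (g : G) :
  covering_difference_set S -> (0 < diff_mult S g)%N.
Proof.
move=> /(_ g)[t [t' [St St' def_g]]]; rewrite card_gt0; apply/set0Pn.
by exists (t, t'); rewrite !inE St St' def_g eqxx.
Qed.

(** From [g = t - t'] and [g = - g] follows [g = t' - t], a second ordered pair since [t] and [t']
    differ. *)
Lemma diff_mult_involution (G : finZmodType) (S : {set G}) (g : G) :
    covering_difference_set S -> g != 0 -> g *+ 2 = 0 ->
  (1 < diff_mult S g)%N.
Proof.
move=> /(_ g)[t [t' [St St' def_g]]] g_neq0 g2.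
have neq_t : t != t' by rewrite -subr_eq0 -def_g.
have def_g' : t' - t = g.
  by rewrite -opprB -def_g; apply/esym/eqP; rewrite -addr_eq0 -mulr2n g2.
have <- : #|[set (t, t'); (t', t)]| = 2%N.
  by rewrite cards2 xpair_eqE negb_and neq_t.
apply: subset_leq_card; apply/subsetP=> p; rewrite !inE.
by case/orP=> /eqP-> /=; rewrite St St' ?def_g' -?def_g eqxx.
Qed.

Lemma leq_card_sum (T : finType) (P : pred T) (f : T -> nat) :
  (forall x, 0 < f x)%N -> (#|P| <= \sum_(x | P x) f x)%N.
Proof. by move=> f_gt0; rewrite -sum1_card leq_sum. Qed.

(** Of the ordered pairs, [#|S|] have difference 0 and each nonzero element takes at least one
    more. *)
Lemma leq_card_covering (G : finZmodType) (S : {set G}) :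
  covering_difference_set S -> (#|G| + #|S| <= #|S| ^ 2 + 1)%N.
Proof.
move=> covS; have := sum_diff_mult S predT; rewrite (bigD1 0) //= diff_mult0.
have := leq_card_sum (predC1 0) (fun g => diff_mult_gt0 g covS).
have -> : [set p in setX S S | true] = setX S S by apply/setP=> p; rewrite !inE andbT.
have : (0 < #|G|)%N by apply/card_gt0P; exists 0.
have -> : #|predC1 (0 : G)| = #|G|.-1 := cardC1 _.
by rewrite cardsX mulnn /=; set u := (\sum_(_ | _) _)%N; lia.
Qed.

(** With index 2, the coset of an element outside [H] is the whole complement of [H]. *)
Lemma index2_sub (G : finZmodType) (H : {group G}) (x y : G) :
    (#|G| = #|H| * 2)%N ->
  (x - y \in H) = ((x \in H) == (y \in H)).
Proof.
move=> oG; have mem_sub z w : (z - w \in H) = (z * w^-1 \in H)%g by [].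
rewrite mem_sub; case Hy: (y \in H); first by rewrite groupMr ?groupV // eqb_id.
rewrite -mem_rcoset (_ : (H :* y)%g = ~: H) ?inE ?eqbF_neg //.
apply/eqP; rewrite eqEcard card_rcoset.
apply/andP; split; last by rewrite -(leq_add2l #|H|) addnn -muln2 -oG cardsC.
by apply/subsetP=> z /rcosetP[w Hw ->]; rewrite inE groupMl ?Hy.
Qed.

(** Differences in [H] come from pairs on the same side of [H], the others from pairs on opposite
    sides, taken in both orders. *)
Lemma card_diff_index2 (G : finZmodType) (H : {group G}) (S : {set G}) :
    (#|G| = #|H| * 2)%N ->
  (\sum_(g in H) diff_mult S g = #|S :&: H| ^ 2 + #|S :\: H| ^ 2)%N
  /\ (\sum_(g in ~: H) diff_mult S g = 2 * (#|S :&: H| * #|S :\: H|))%N.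
Proof.
set A := S :&: H; set B := S :\: H => oG; rewrite !sum_diff_mult.
have in_A x : (x \in A) = (x \in S) && (x \in H) by rewrite inE.
have in_B x : (x \in B) = (x \in S) && (x \notin H) by rewrite inE andbC.
split.
  have AB0 : setX A A :&: setX B B = set0.
    by apply/setP=> -[x y]; rewrite !inE; case: (x \in H); rewrite ?andbF.
  rewrite -!mulnn -!cardsX -[RHS]subn0 -(cards0 (G * G)%type) -AB0 -cardsU.
  apply: eq_card => -[x y]; rewrite !in_setU !in_setX !in_A !in_B inE in_setX /=.
  rewrite index2_sub //.
  by case: (x \in S); case: (y \in S); case: (x \in H); case: (y \in H).
have AB0 : setX A B :&: setX B A = set0.
  by apply/setP=> -[x y]; rewrite !inE; case: (x \in H); rewrite ?andbF.
rewrite mul2n -addnn [X in (_ = _ + X)%N]mulnC.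
rewrite -!cardsX -[RHS]subn0 -(cards0 (G * G)%type) -AB0 -cardsU.
apply: eq_card => -[x y]; rewrite !in_setU !in_setX !in_A !in_B !inE /=.
rewrite index2_sub //.
by case: (x \in S); case: (y \in S); case: (x \in H); case: (y \in H).
Qed.

Lemma cyclic_of_covering40 (G : finZmodType) (S : {set G}) :
  #|G| = 40%N -> #|S| = 7%N -> covering_difference_set S -> cyclic [set: G].
Proof.
move=> oG oS covS; apply: contraT => ncG.
have [|H [t [_ oH _ nHt]]] := abelian_index2_involution (FinRing.zmod_abelian _) _ ncG.
  by rewrite cardsT.
rewrite FinRing.zmodXgE FinRing.zmod1gE => t2.
have t_neq0 : t != 0 by apply: contraNneq nHt => ->; apply: group1.
have [] := card_diff_index2 (H := H) S; first by rewrite oG oH.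
rewrite (bigD1 0) ?group1 //= diff_mult0 oS => sumH.
rewrite (bigD1 t) ?inE //= => sumHC; move: sumH sumHC.
have mult_gt0 g := diff_mult_gt0 g covS.
have := diff_mult_involution covS t_neq0 t2.
have : (19 <= \sum_(g in H | g != 0%R) diff_mult S g)%N.
  apply: leq_trans (leq_card_sum _ mult_gt0).
  have := cardD1 0 (mem H); rewrite group1 oH => -[->].
  by apply/subset_leq_card/subsetP=> g; rewrite !inE => /andP[g0 Hg]; apply/andP.
have : (19 <= \sum_(g in ~: H | g != t) diff_mult S g)%N.
  apply: leq_trans (leq_card_sum _ mult_gt0).
  have oHC : #|~: H| = 20%N by apply: (@addnI 20); rewrite -[X in (X + _)%N]oH cardsC oG.
  have := cardD1 t (mem (~: H)); rewrite oHC inE nHt => -[->].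
  by apply/subset_leq_card/subsetP=> g; rewrite !inE => /andP[gt Hg]; rewrite unfold_in inE Hg.
have := cardsID H S; rewrite oS.
move: #|_ :&: _| #|_ :\: _| (diff_mult S t) => a b mt.
move: (\sum_(g in H | g != 0%R) diff_mult S g)%N (\sum_(g in ~: H | g != t) diff_mult S g)%N.
(* Splitting on [a] makes the products linear for [lia]: only 3 + 4 gives [2ab >= 21], and then the
   squares sum to 25, below 26. *)
have [lt_a | le_a] := ltnP a 8; last by lia.
by case: a lt_a => [|[|[|[|[|[|[|[|a]]]]]]]] //=; lia.
Qed.

Local Close Scope ring_scope.

(** * The upper bound 39 *)

(** Each Sylow subgroup is trivial or of prime order, hence cyclic, and a nilpotent group with
    cyclic Sylow subgroups is cyclic. *)
Lemma abelian_squarefree_cyclic (gT : finGroupType) (G : {group gT}) :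
    abelian G -> all (fun p => logn p #|G| == 1) (primes #|G|) -> cyclic G.
Proof.
move=> cGG /allP sqfree; apply: nil_Zgroup_cyclic (abelian_nil cGG).
apply/forall_inP=> V /SylowP[p p_pr sylV].
apply: (dvdn_prime_cyclic p_pr); rewrite (card_Hall sylV) p_part.
case: (boolP (p \in primes #|G|)) => [/sqfree/eqP-> // | ].
by rewrite -logn_gt0 -eqn0Ngt => /eqP->.
Qed.

Lemma search7_fails :
  all (fun n => ~~ search n (n - 2) (7 - 2) [:: 1; 0] (iota 2 n./2.-1)) [:: 40; 41; 42; 43].
Proof. by vm_compute. Qed.

Lemma covering7_leq39 (G : finZmodType) (S : {set G}) :
  #|S| = 7 -> covering_difference_set S -> #|G| <= 39.
Proof.
move=> oS covS; have := leq_card_covering covS; rewrite oS => le_oG.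
rewrite leqNgt; apply/negP=> lt_oG.
have cGG : abelian [set: G] := FinRing.zmod_abelian _.
have : #|G| \in [:: 40; 41; 42; 43] by rewrite !inE; lia.
have sqfree_cyclic : all (fun p => logn p #|G| == 1) (primes #|G|) -> cyclic [set: G].
  by rewrite -cardsT; apply: abelian_squarefree_cyclic.
move=> oG_in; suff cycG : cyclic [set: G].
  have := cyclic_search (ltn_trans _ lt_oG) cycG covS; rewrite oS => /(_ isT).
  by apply/negP; apply: (allP search7_fails _ oG_in).
move: oG_in; rewrite !inE => /or4P[] /eqP oG; first exact: cyclic_of_covering40 oG oS covS.
all: by apply: sqfree_cyclic; rewrite oG.
Qed.

(** * The almost difference set modulo 39 *)

Definition diffs39 (g : nat) : nat :=
  let s := [:: 0; 1; 2; 4; 13; 18; 33] in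
  count (fun p : nat * nat => (p.1 + (39 - p.2)) %% 39 == g)
    [seq (a, b) | a <- s, b <- s].

(** Trades the cardinality of a finite set for a count over explicit pairs, which can be
    evaluated. *)
Lemma diff_mult_seq (G : finZmodType) (S : {set G}) (s : seq G) (g : G) :
    uniq s -> S =i s ->
  diff_mult S g = count (fun p => p.1 - p.2 == g)%R [seq (a, b) | a <- s, b <- s].
Proof.
move=> uniq_s memS; pose P := [pred p : G * G | p.1 - p.2 == g]%R.
have uniq_ss : uniq [seq (a, b) | a <- s, b <- s].
  by apply: allpairs_uniq => // -[a b] [c d].
rewrite -size_filter -(card_uniqP (filter_uniq P uniq_ss)).
apply: eq_card => -[x y]; rewrite mem_filter !inE !memS andbC; congr (_ && _).
apply/andP/allpairsP=> [[sx sy] | [[a b] [sa sb [-> ->]]] //].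
by exists (x, y).
Qed.

Lemma mem_S39 : S39 =i [:: 0; 1; 2; 4; 13; 18; 33]%R.
Proof. by move=> x; rewrite !inE -!orbA. Qed.

Lemma diff_mult_S39 (g : 'Z_39) : diff_mult S39 g = diffs39 g.
Proof. by rewrite (diff_mult_seq _ _ mem_S39). Qed.

Lemma diffs39_spec :
  all (fun g => if g is 0 then true else (diffs39 g == 1) || (diffs39 g == 2)) (iota 0 39)
  /\ count (fun g => (g != 0) && (diffs39 g == 1)) (iota 0 39) = 34.
Proof. by []. Qed.

Theorem proposition3p2 :
  is_maximum (has_covering_order 7) 39 /\
  almost_difference_set 39 7 1 34 S39 /\
  covering_difference_set S39.
Proof.
have oS39 : #|S39| = 7.
  by rewrite (eq_card mem_S39); apply/card_uniqP.
have mults (g : 'Z_39) : g != 0%R -> (diff_mult S39 g == 1) || (diff_mult S39 g == 2).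
  have [/allP diffs12 _] := diffs39_spec.
  rewrite diff_mult_S39; have := diffs12 g; rewrite mem_iota ltn_ord => /(_ isT).
  by case: g => -[].
have covS39 : covering_difference_set S39.
  move=> g; have : 0 < diff_mult S39 g.
    have [-> | /mults/orP[]/eqP-> //] := eqVneq g 0%R.
    by rewrite diff_mult0 oS39.
  rewrite card_gt0 => /set0Pn[[t t']]; rewrite !inE /= => /andP[/andP[St St'] /eqP <-].
  by exists t, t'; rewrite !inE.
split; first split.
- by exists 'Z_39, S39; split; rewrite ?card_ord.
- by move=> m [G [S [<- oS covS]]]; apply: covering7_leq39 oS covS.
split=> //; split=> //; first by rewrite card_ord.
- have [_ count1] := diffs39_spec; apply: etrans count1.
  rewrite cardsE -(val_enum_ord 39) count_map cardE size_filter -enumT.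
  by apply: eq_count => g; rewrite /= -diff_mult_S39.
- by move=> g /mults/orP[]/eqP->.
Qed.
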